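(* Let $\{G_n\}_{n=1}^{\infty}$ be a type-1-sequence and $\{J_n\}_{n=1}^{\infty}$ a type-2-sequence. Then: 1. The odd and even subsequences of $\{G_n\}_{n=1}^{\infty}$ are of type 2. 2. The odd and even subsequences of $\{J_n\}_{n=1}^{\infty}$ are also of type 2.
   Context: A type-1-sequence is a sequence $\{G_n\}_{n=1}^\infty$ defined by $G_1 = 1$, $G_2 = a$, and $G_n = pG_{n-1} + qG_{n-2}$ for $n>2$, where $a,p,q$ are positive integers with $a>1$ and $q \le p$. A type-2-sequence is a sequence $\{J_n\}_{n=1}^\infty$ defined by $J_1 = 1$, $J_2 = a$, and $J_n = pJ_{n-1} - qJ_{n-2}$ for $n>2$, where $a,p,q$ are integers with $p,q>0$, $a>1$ and $1 \le q < p-1$. The values of the parameters $a,p,q$ may differ from one sequence to another. A sequence is said to be of type 2 if it is a type-2-sequence for some values of the parameters. For a sequence $\{x_n\}_{n=1}^\infty$, the odd subsequence is $\{x_{2k-1}\}_{k=1}^\infty$ and the even subsequence is $\{x_{2k}\}_{k=1}^\infty$.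
   Formalization: Even subsequences start with a > 1, so they are never type 2 literally (which needs first term 1); for them ''type 2'' is read with initial value 1 replaced by x_2, and a > 1 by second term > x_2, keeping the recurrence and 1 ≤ q < p−1. *)

(* Defs.v *)
From mathcomp Require Import all_boot all_order all_algebra.
Set Implicit Arguments.
Unset Strict Implicit.
Unset Printing Implicit Defensive.

Import Order.TTheory GRing.Theory Num.Theory.
Local Open Scope ring_scope.

(* A sequence {x_n}_{n >= 1} of integers is a function nat -> int whose value
   at 0 is irrelevant: no definition below constrains it. *)

Definition type1 (x : nat -> int) : Prop :=
  exists a p q : int,
    [/\ [/\ 0 < p, 0 < q, 1 < a & q <= p], x 1%N = 1, x 2%N = a
      & forall n : nat, (2 < n)%N -> x n = p * x n.-1 + q * x n.-2].

(* The family of type-2-sequences, with the initial value 1 replaced by b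
   (so that the condition 1 < a on the second term becomes b < a). *)
Definition type2_from (b : int) (x : nat -> int) : Prop :=
  exists a p q : int,
    [/\ [/\ 0 < p, 0 < q, b < a & 1 <= q < p - 1], x 1%N = b, x 2%N = a
      & forall n : nat, (2 < n)%N -> x n = p * x n.-1 - q * x n.-2].

(* The initial value b is kept separate because the even subsequence of a
   type-1- or type-2-sequence starts with x_2 = a > 1, so it never satisfies
   [type2] on the nose; what holds of it is [type2_from (x 2)]. *)
Definition type2 (x : nat -> int) : Prop := type2_from 1 x.

Definition odd_subseq (x : nat -> int) : nat -> int := fun k => x (2 * k - 1)%N.

Definition even_subseq (x : nat -> int) : nat -> int := fun k => x (2 * k)%N.

(* Main.v *)
Require Import Defs.
From mathcomp Require Import all_boot all_order all_algebra.
From mathcomp Require Import zify ring.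
Set Implicit Arguments.
Unset Strict Implicit.
Unset Printing Implicit Defensive.

Import Order.TTheory GRing.Theory Num.Theory.
Local Open Scope ring_scope.

(** If x_n = p x_(n-1) + c x_(n-2), eliminating the terms of the other parity
    gives x_(n+4) = (p^2 + 2c) x_(n+2) - c^2 x_n. Type 1 is the case c = q and
    type 2 the case c = -q, so in both cases only inequalities remain. *)

Lemma bisection_rec (R : comPzRingType) (p c : R) (x : nat -> R) :
  (forall n, (2 < n)%N -> x n = p * x n.-1 + c * x n.-2) ->
  forall m, (0 < m)%N ->
    x m.+4 = (p ^+ 2 + c *+ 2) * x m.+2 - c ^+ 2 * x m.
Proof.
move=> rec m m_gt0.
have -> : x m.+4 = p * x m.+3 + c * x m.+2 by rewrite rec.
have -> : x m.+3 = p * x m.+2 + c * x m.+1 by rewrite rec.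
(* Both sides become linear in [x m.+1] and [x m], and the coefficients agree. *)
have -> : x m.+2 = p * x m.+1 + c * x m by rewrite rec.
ring.
Qed.

(** Both halves obey the same recurrence, with parameters [p ^+ 2 + c *+ 2] and [c ^+ 2]; the
    hypotheses are the inequalities that [type2_from] asks of these and of the initial terms. *)
Lemma bisection_type2 (p c : int) (x : nat -> int) :
  (forall n, (2 < n)%N -> x n = p * x n.-1 + c * x n.-2) ->
  1 <= c ^+ 2 < p ^+ 2 + c *+ 2 - 1 ->
  x 1%N < x 3%N -> x 2%N < x 4%N ->
  type2_from (x 1%N) (odd_subseq x) /\ type2_from (x 2%N) (even_subseq x).
Proof.
move=> /bisection_rec rec /andP[c_ge1 c_lt] x13 x24.
have P_gt0 : 0 < p ^+ 2 + c *+ 2 by lia.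
have Q_gt0 : 0 < c ^+ 2 by lia.
split.
- exists (x 3%N), (p ^+ 2 + c *+ 2), (c ^+ 2); split=> //.
    by split=> //; apply/andP.
  case=> [|[|[|k]]] // _; rewrite /odd_subseq /=.
  (* The bisected recurrence is used at [m = 2k + 1]. *)
  have -> : (2 * k.+3 - 1 = (2 * k).+1.+4)%N by lia.
  have -> : (2 * k.+2 - 1 = (2 * k).+1.+2)%N by lia.
  have -> : (2 * k.+1 - 1 = (2 * k).+1)%N by lia.
  exact: rec.
- exists (x 4%N), (p ^+ 2 + c *+ 2), (c ^+ 2); split=> //.
    by split=> //; apply/andP.
  case=> [|[|[|k]]] // _; rewrite /even_subseq /=.
  have -> : (2 * k.+3 = (2 * k.+1).+4)%N by lia.
  have -> : (2 * k.+2 = (2 * k.+1).+2)%N by lia.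
  exact: rec.
Qed.

Lemma type1_bisection (x : nat -> int) : type1 x ->
  type2 (odd_subseq x) /\ type2_from (x 2%N) (even_subseq x).
Proof.
case=> a [p [q [[p_gt0 q_gt0 a_gt1 le_qp] x1 x2 rec]]].
have x3 : x 3%N = p * a + q by rewrite rec //= x2 x1 mulr1.
have x4 : x 4%N = p * (p * a + q) + q * a by rewrite rec //= x3 x2.
rewrite /type2 -x1; apply: (bisection_type2 rec).
(* Here [q <= p] gives [q^2 <= p^2], and [2q - 1 > 0]. *)
- by apply/andP; split; nia.
- by rewrite x1 x3; nia.
- by rewrite x2 x4; nia.
Qed.

Lemma type2_bisection (x : nat -> int) : type2 x ->
  type2 (odd_subseq x) /\ type2_from (x 2%N) (even_subseq x).
Proof.
case=> a [p [q [[p_gt0 q_gt0 a_gt1 /andP[q_ge1 lt_qp]] x1 x2 rec]]].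
have x3 : x 3%N = p * a - q by rewrite rec //= x2 x1 mulr1.
have x4 : x 4%N = p * x 3%N - q * a by rewrite rec //= x2.
(* Since [p - 1 > q], a positive increasing pair of consecutive terms is followed by a larger term:
   [(p - 1) * v > q * v > q * u] when [0 < u < v]. The first pair is [1 < a]. *)
have x23 : a < x 3%N by rewrite x3; nia.
have x34 : x 3%N < x 4%N by rewrite x4; nia.
have recN n : (2 < n)%N -> x n = p * x n.-1 + - q * x n.-2.
  by move=> n_gt2; rewrite rec // mulNr.
rewrite /type2 -x1; apply: (bisection_type2 recN).
(* The upper bound amounts to [(q + 1)^2 < p^2], that is, [q < p - 1]. *)
- by apply/andP; split; nia.
- by rewrite x1; lia.
- by rewrite x2; lia.
Qed.

Local Close Scope ring_scope.

Theorem proposition4 (G J : nat -> int) (hG : type1 G) (hJ : type2 J) :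
  (type2 (odd_subseq G) /\ type2_from (G 2) (even_subseq G)) /\
  (type2 (odd_subseq J) /\ type2_from (J 2) (even_subseq J)).
Proof. by split; [exact: type1_bisection | exact: type2_bisection]. Qed.
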